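(* Let $S=\{a_1<a_2<a_3<\dots\}$ be an infinite set of positive integers with $\gcd(S)=1$, and let $M$ be the set of all nonnegative integers. For each $n$ let $j(n)$ be the least integer $j$ such that $j\,a_j\ge n$. Then for all sufficiently large $n$, $$p(n;S,M)\ge \frac{(n+1)^{j(n)-1}}{j(n)!\,a_1a_2\cdots a_{j(n)}}.$$
   Context: $p(n;S,M)$ denotes the number of partitions of $n$ all of whose parts belong to $S$ and whose part multiplicities belong to $M$; with $M$ all nonnegative integers this is just the number of partitions of $n$ into parts from $S$. The elements of $S$ are listed in increasing order $a_1<a_2<\cdots$. *)

(* Defs.v *)
From mathcomp Require Import all_boot all_order all_algebra.
From mathcomp Require Import finmap.
From mathcomp Require Import boolp classical_sets functions cardinality.

Set Implicit Arguments.
Unset Strict Implicit.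
Unset Printing Implicit Defensive.

Local Open Scope classical_set_scope.

Definition is_partition (n : nat) (s : seq nat) : bool :=
  [&& sorted geq s, 0 \notin s & sumn s == n].

Definition partitions (n : nat) (S M : set nat) : set (seq nat) :=
  [set s | is_partition n s /\
           forall k, k \in s -> S k /\ M (count_mem k s)].

(* [fset_set] is the genuine conversion to a finite set only on finite sets;
   the following fact shows that its default value is never used below. *)
Lemma finite_partitions (n : nat) (S M : set nat) :
  finite_set (partitions n S M).
Proof.
pose f (b : {bseq n of 'I_n.+1}) : seq nat := map val (bseqval b).
apply: (@sub_finite_set _ _ (f @` setT)); last first.
  exact/finite_image/finite_finset.
move=> s [/and3P[_ s0 /eqP sn] _].
have le_sn k : k \in s -> k < n.+1.
  move=> ks; rewrite ltnS -sn sumnE (perm_big _ (perm_to_rem ks)) big_cons.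
  exact: leq_addr.
have sz_s : size (map (@inord n) s) <= n.
  rewrite size_map -sn; elim: s s0 {sn le_sn} => //= k s IHs.
  rewrite inE negb_or eq_sym -lt0n => /andP[k0 /IHs].
  by rewrite -(leq_add2l 1) => /leq_trans; apply; rewrite leq_add2r.
exists (Bseq sz_s) => //; rewrite /f /= -map_comp -[RHS]map_id.
by apply/eq_in_map => k /le_sn kn /=; rewrite inordK.
Qed.

Definition num_partitions (n : nat) (S M : set nat) : nat :=
  #|` fset_set (partitions n S M)|%fset.

(* [a 1 < a 2 < ...] lists [S]; the value [a 0] is irrelevant. *)
Definition increasing_enumeration (S : set nat) (a : nat -> nat) : Prop :=
  (forall i j, 1 <= i -> i < j -> a i < a j) /\
  S = a @` [set i | 1 <= i].

Definition gcd_eq1 (S : set nat) : Prop :=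
  forall d, (forall s, S s -> d %| s) -> d = 1.

Definition is_least_index (a : nat -> nat) (n j : nat) : Prop :=
  [/\ 1 <= j, n <= j * a j &
      forall i, 1 <= i -> n <= i * a i -> j <= i].

(* Main.v *)
Require Import Defs.
From mathcomp Require Import all_boot all_order all_algebra.
From mathcomp Require Import finmap.
From mathcomp Require Import boolp classical_sets functions cardinality.
From mathcomp Require Import zify.

Import GRing.Theory Num.Theory.

Local Open Scope classical_set_scope.
Local Open Scope ring_scope.

(* Fix a list [l] of elements of [S] whose sum is [1] modulo [a_1], and put
   [C = a_1 * sumn l].  The tuples [(x_2, ..., x_j)] with
   [\sum_i a_i x_i <= n - C] number at least
   [(n - C + 1)^(j-1) / ((j-1)! a_2 ... a_j)], the volume of a simplex.  Each
   completes to a partition of [n] by fewer than [a_1] copies of [l] and some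
   copies of [a_1], and each partition arises at most [a_1] times, so that
   [p(n) >= (n + 1 - C)^(j-1) / ((j-1)! a_1 ... a_j)].  Since
   [(j - 1) a_(j-1) < n] and [a_(j-1)] is unbounded, [C j <= n + 1] eventually,
   and Bernoulli's inequality gives [j (n + 1 - C)^(j-1) >= (n + 1)^(j-1)]. *)

(** Bernoulli's inequality for [1 - b / m], cleared of denominators. Truncated subtraction is
    harmless: for [b > m] the last term alone suffices. *)
Lemma expn_bernoulli (m b k : nat) :
  (m ^ k.+1 <= (m - b) ^ k.+1 + k.+1 * b * m ^ k)%N.
Proof.
elim: k => [|k IHk]; first by rewrite !expn1 expn0; lia.
have h : ((m - b) ^ k.+1 * m <= (m - b) ^ k.+1 * (m - b) + b * m ^ k.+1)%N.
  have le1 : ((m - b) ^ k.+1 <= m ^ k.+1)%N by rewrite leq_exp2r ?leq_subr.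
  have le2 : (m <= m - b + b)%N by lia.
  apply: (leq_trans (leq_mul (leqnn _) le2)).
  by rewrite mulnDr leq_add2l mulnC leq_mul2l le1 orbT.
rewrite expnS [((m - b) ^ k.+2)%N]expnS.
rewrite [(m ^ k.+1)%N in X in (_ <= _ + X)%N]expnS.
move: h; rewrite [(m ^ k.+1)%N in X in (_ <= _ + X)%N -> _]expnS.
by move: IHk; nia.
Qed.

(* The bound is the volume of the simplex [\sum_i b_i y_i <= N + 1]; the list
   is built by splitting on whether the first coordinate vanishes. *)
Lemma simplex_lattice_points (k : nat) (b : nat -> nat) (N : nat) :
    (forall i, 0 < b i)%N ->
  exists L : seq (seq nat), [/\ uniq L,
    forall s, s \in L ->
      size s = k /\ (\sum_(i < k) b i * nth 0 s i <= N)%N &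
    (N.+1 ^ k <= k`! * (\prod_(i < k) b i) * size L)%N].
Proof.
elim: k b N => [|k IHk] b N b_gt0.
  exists [:: [::]]; split=> // [s|]; last by rewrite big_ord0.
  by rewrite inE => /eqP->; rewrite big_ord0.
elim/ltn_ind: N => N IHN.
have [L0 [uL0 L0P szL0]] := IHk (fun i => b i.+1) N (fun i => b_gt0 i.+1).
have inj0 : injective (cons 0%N) by move=> s t [].
have L0P' s : s \in [seq 0%N :: t | t <- L0] ->
    size s = k.+1 /\ (\sum_(i < k.+1) b i * nth 0 s i <= N)%N.
  case/mapP=> t /L0P[szt tN] ->; split; first by rewrite /= szt.
  by rewrite big_ord_recl /= muln0.
have powN := expn_bernoulli N.+1 (b 0%N) k.
(* Tuples with zero first coordinate pay for the linear term of Bernoulli's inequality; the others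
   will pay for the power of [N.+1 - b 0]. *)
have szL0' : (k.+1 * b 0%N * N.+1 ^ k <=
    k.+1`! * (\prod_(i < k.+1) b i) * size L0)%N.
  rewrite big_ord_recl factS.
  move: szL0; rewrite -(leq_pmul2l (_ : 0 < k.+1 * b 0%N)%N) ?muln_gt0 ?b_gt0 //.
  move=> /leq_trans; apply; rewrite eq_leq //=.
  by rewrite -!mulnA; congr (_ * _)%N; rewrite mulnCA.
have [ltNb | leNb] := ltnP N (b 0%N).
  exists [seq 0%N :: t | t <- L0]; split=> //.
    by rewrite map_inj_uniq.
  rewrite size_map (leq_trans powN) //.
  by rewrite (_ : (N.+1 - b 0%N = 0)%N) ?exp0n ?add0n //; lia.
have [|L1 [uL1 L1P szL1]] := IHN (N - b 0%N)%N; first by have := b_gt0 0%N; lia.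
pose incr s := (head 0 s).+1 :: behead s.
exists ([seq 0%N :: t | t <- L0] ++ [seq incr t | t <- L1]); split.
- rewrite cat_uniq map_inj_uniq // uL0 /= map_inj_in_uniq ?uL1 ?andbT.
    by apply/hasPn=> _ /mapP[t _ ->]; apply/mapP=> -[].
  by move=> [|x s] [|y t] /L1P[// _ _] /L1P[// _ _] [-> ->].
- move=> s; rewrite mem_cat => /orP[/L0P'//|/mapP[[|x t] /L1P[// [szt] tN] ->]].
  split; first by rewrite /= szt.
  by move: tN; rewrite !big_ord_recl /= mulnS; lia.
- rewrite size_cat !size_map mulnDr (leq_trans powN) // addnC leq_add //.
  by rewrite -subSn // in szL1.
Qed.

(* Modulo [c] the sums of elements of [S] form a group, generated by its least
   positive representative, which divides every element of [S]. *)
Lemma gcd1_sum_eq1_mod (S : set nat) (c : nat) :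
    gcd_eq1 S -> S c -> (0 < c)%N ->
  exists l : seq nat, (forall x, x \in l -> S x) /\ (sumn l = 1 %[mod c])%N.
Proof.
move=> S_gcd Sc c_gt0.
pose R m := exists l : seq nat,
  (forall x, x \in l -> S x) /\ (sumn l = m %[mod c])%N.
have RS x : S x -> R x.
  by move=> Sx; exists [:: x]; split=> [y|]; rewrite ?inE ?[sumn _]addn0 // => /eqP->.
have RD m p : R m -> R p -> R (m + p)%N.
  move=> [l [lS lm]] [l' [lS' lp]]; exists (l ++ l'); split.
    by move=> x; rewrite mem_cat => /orP[/lS|/lS'].
  by rewrite sumn_cat -modnDm lm lp modnDm.
have RM q m : R m -> R (q * m)%N.
  by move=> Rm; elim: q => [|q IHq]; [exists [::] | rewrite mulSn; apply: RD].
have exR : exists m, (0 < m)%N && `[< R m >].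
  by exists c; rewrite c_gt0; apply/asboolP/RS.
case: (ex_minnP exR) => d /andP[d_gt0 /asboolP Rd] d_min.
have d_dvd m : R m -> (d %| m)%N.
  move=> Rm; rewrite /dvdn; apply: contraT; rewrite -lt0n => r_gt0.
  have Rr : R (m %% d)%N.
    (* Since [c.-1] is [-1] modulo [c], this addition subtracts [m %/ d] copies of [d]. *)
    have [l [lS lE]] := RD _ _ Rm (RM (m %/ d * c.-1)%N _ Rd).
    exists l; split=> //; rewrite lE {1}(divn_eq m d).
    rewrite (_ : _ + _ = m %/ d * d * c + m %% d)%N ?modnMDl //.
    by case: (c) c_gt0 => //= c' _; rewrite mulnS mulnAC; lia.
  have := d_min (m %% d)%N; rewrite r_gt0 asboolT //= => /(_ isT).
  by rewrite leqNgt ltn_mod d_gt0.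
by have <- : d = 1%N by apply: S_gcd => s /RS /d_dvd.
Qed.

Section Counting.
Variables (S : set nat) (a : nat -> nat).
Hypotheses (S_pos : forall s, S s -> (0 < s)%N)
  (S_enum : increasing_enumeration S a).

Lemma enum_mem i : S (a i.+1).
Proof. by case: S_enum => _ ->; exists i.+1. Qed.

Lemma enum_gt0 i : (0 < a i.+1)%N.
Proof. exact/S_pos/enum_mem. Qed.

Lemma enum_inj i j : a i.+1 = a j.+1 -> i = j.
Proof.
case: S_enum => incr _ aij.
have [ltij|ltji|//] := ltngtP i j.
  by have := incr i.+1 j.+1 isT ltij; rewrite aij ltnn.
by have := incr j.+1 i.+1 isT ltji; rewrite aij ltnn.
Qed.

Lemma enum_gt i : (i < a i.+1)%N.
Proof.
elim: i => [|i IHi]; first exact: enum_gt0.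
by case: S_enum => incr _; apply: leq_ltn_trans IHi (incr _ _ _ _).
Qed.

(** Coordinate [i] is the multiplicity of [a i.+2], as [a 1] is reserved for filling up to [n]. *)
Definition parts_of (k : nat) (s : seq nat) : seq nat :=
  flatten [seq nseq (nth 0%N s i) (a i.+2) | i <- iota 0 k].

Lemma sumn_parts_of k s :
  sumn (parts_of k s) = (\sum_(i < k) a i.+2 * nth 0 s i)%N.
Proof.
rewrite /parts_of sumn_flatten -map_comp sumnE big_map.
rewrite -(big_mkord xpredT (fun i => a i.+2 * nth 0%N s i)%N) /index_iota subn0.
by apply: eq_bigr => i _ /=; rewrite sumn_nseq.
Qed.

Lemma mem_parts_of k s x : x \in parts_of k s -> S x.
Proof.
case/flattenP=> _ /mapP[i _ ->]; rewrite mem_nseq => /andP[_ /eqP->].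
exact: enum_mem.
Qed.

Lemma count_parts_of k s i :
  (i < k)%N -> count_mem (a i.+2) (parts_of k s) = nth 0%N s i.
Proof.
move=> lt_ik; rewrite /parts_of count_flatten -map_comp sumnE big_map.
rewrite (bigD1_seq i) ?mem_iota ?iota_uniq //= count_nseq /= eqxx mul1n.
rewrite big1 ?addn0 // => h /eqP neq_hi; rewrite count_nseq /=.
by case: eqP => // /enum_inj[] /neq_hi.
Qed.

(* A tuple is recovered from its partition and the residue modulo [a 1] that
   the copies of [l] correct, since the multiplicities of [l] are known. *)
Lemma num_partitions_lower_bound (l : seq nat) (n k : nat) :
    (forall x, x \in l -> S x) -> (sumn l = 1 %[mod a 1])%N ->
    (a 1 * sumn l <= n)%N ->
  ((n - a 1 * sumn l).+1 ^ k <=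
     k`! * (\prod_(1 <= i < k.+2) a i) * num_partitions n S setT)%N.
Proof.
move=> lS l1; set C := (a 1 * sumn l)%N => leCn.
have [L [uL LP szL]] := @simplex_lattice_points k (fun i => a i.+2) (n - C)
  (fun i => enum_gt0 i.+1).
(* Each copy of [l] adds 1 modulo [a 1], so [res s] copies leave a multiple of [a 1] to fill; being
   fewer than [a 1], they fit in the reserve [C]. *)
pose res s := ((n - sumn (parts_of k s)) %% a 1)%N.
pose fixed s := parts_of k s ++ flatten (nseq (res s) l).
pose full s := fixed s ++ nseq ((n - sumn (fixed s)) %/ a 1) (a 1).
pose f s := (sort geq (full s), res s).
have sum_fixed s : sumn (fixed s) = (sumn (parts_of k s) + res s * sumn l)%N.
  by rewrite sumn_cat sumn_flatten map_nseq sumn_nseq mulnC.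
have full_n s : s \in L -> sumn (full s) = n.
  case/LP=> _; rewrite -sumn_parts_of => les.
  have ltr : (res s < a 1)%N by rewrite ltn_mod enum_gt0.
  have lefix : (sumn (fixed s) <= n)%N.
    have := leq_mul (ltnW ltr) (leqnn (sumn l)).
    by rewrite sum_fixed -/C; lia.
  rewrite sumn_cat sumn_nseq mulnC divnK ?subnKC //.
  rewrite -eqn_mod_dvd // sum_fixed.
  rewrite -[X in X == _ %[mod _]](@subnKC (sumn (parts_of k s))); last by lia.
  by rewrite eqn_modDl -[(res s * _ %% _)%N]modnMm l1 modnMm muln1 modn_mod.
have full_S s x : x \in full s -> S x.
  rewrite !mem_cat => /orP[/orP[/mem_parts_of//|]|].
    by case/flattenP=> t; rewrite mem_nseq => /andP[_ /eqP->] /lS.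
  by rewrite mem_nseq => /andP[_ /eqP->]; apply: enum_mem.
have f_inj : {in L &, injective f}.
  move=> s t sL tL [/(congr1 (fun p i => count_mem (a i.+2) p)) eq_st eq_res].
  have [[szs _] [szt _]] := (LP s sL, LP t tL).
  apply: (@eq_from_nth _ 0%N) => [|i]; rewrite szs ?szt // => lt_ik.
  have := congr1 (fun g => g i) eq_st; rewrite /= !count_sort !count_cat.
  rewrite !count_parts_of // eq_res !count_nseq /=.
  by case: eqP => [/enum_inj//|_]; rewrite !mul0n !addn0 => /addIn.
have sub_f : {subset [seq f s | s <- L] <=
    [seq (p, r) | p <- fset_set (partitions n S setT), r <- iota 0 (a 1)]}.
  move=> _ /mapP[s sL ->]; apply/allpairsP; exists (f s); split=> //=; last first.
    by rewrite mem_iota add0n ltn_mod enum_gt0.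
  rewrite in_fset_set; last exact: finite_partitions.
  rewrite inE; split; last by move=> x; rewrite mem_sort => /full_S.
  apply/and3P; split.
  - by apply: sort_sorted => x y; apply: leq_total.
  - by rewrite mem_sort; apply/negP=> /full_S /S_pos.
  - by rewrite sumnE (perm_big _ (permEl (perm_sort geq _))) -sumnE full_n.
have := uniq_leq_size _ sub_f.
rewrite map_inj_in_uniq // => /(_ uL); rewrite size_map size_allpairs size_iota.
move=> szLP; apply: (leq_trans szL); rewrite -!mulnA leq_mul2l; apply/orP; right.
(* The [a 1] possible residues supply the missing factor [a 1] of the product. *)
rewrite big_nat_recl // big_add1 /= big_mkord -!mulnA.
by rewrite mulnCA leq_mul2l [(a 1 * _)%N]mulnC szLP orbT.
Qed.

End Counting.

Theorem theorem4 (S : set nat) (a : nat -> nat) (j : nat -> nat)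
    (S_infinite : infinite_set S)
    (S_pos : forall s, S s -> (0 < s)%N)
    (S_gcd : gcd_eq1 S)
    (S_enum : increasing_enumeration S a)
    (j_least : forall n : nat, is_least_index a n (j n)) :
  exists N : nat, forall n : nat, (N <= n)%N ->
    (n%:R + 1) ^+ (j n - 1) /
      ((j n)`!%:R * \prod_(1 <= i < (j n).+1) (a i)%:R)
    <= (num_partitions n S setT)%:R :> rat.
Proof.
have a_gt0 := enum_gt0 _ _ S_pos S_enum.
have [l [lS l1]] := gcd1_sum_eq1_mod _ _ S_gcd (enum_mem _ _ S_enum 0) (a_gt0 0%N).
set C := (a 1 * sumn l)%N.
(* The sum dominates [i * a i] for every [i <= C.*2.+2], which forces [j n] beyond that range. *)
exists (C + \sum_(i < C.*2.+3) i * a i).+1%N => n ltNn.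
have [j_gt0 lenj j_min] := j_least n.
have lt_Cj : (C.*2.+2 < j n)%N.
  rewrite ltnNge; apply/negP => lejC.
  have ltj : (j n < C.*2.+3)%N by [].
  have : (j n * a (j n) <= \sum_(i < C.*2.+3) i * a i)%N.
    by rewrite (bigD1 (Ordinal ltj)) //= leq_addr.
  by lia.
case Ej: (j n) lt_Cj lenj j_min => [//|[//|k]] lt_Ck lenj j_min.
have prev : (k.+1 * a k.+1 < n)%N.
  by rewrite ltnNge; apply/negP => /(j_min k.+1 isT); rewrite ltnn.
(* Here [(k+2) C <= (k+1) 2C <= (k+1) a_(k+1) < n], using [2C < k < a_(k+1)]. *)
have Cj_le_n : (k.+2 * C <= n.+1)%N.
  have le2C : (C.*2 <= a k.+1)%N by have := enum_gt _ _ S_pos S_enum k; lia.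
  have le_prod := leq_mul (leqnn k.+1) le2C.
  have : (k.+2 * C <= k.+1 * C.*2)%N by rewrite -muln2 mulnCA mulnC leq_mul2l; lia.
  by lia.
have leCn : (C <= n)%N by lia.
have count_bound := num_partitions_lower_bound _ _ S_pos S_enum _ _ k.+1 lS l1 leCn.
(* Multiplied by [k+2], the Bernoulli loss is [(k+1) (k+2) C (n+1)^k <= (k+1) (n+1)^(k+1)], so one
   copy of [(n+1)^(k+1)] survives. *)
have bern : (n.+1 ^ k.+1 <= k.+2 * (n - C).+1 ^ k.+1)%N.
  have := leq_mul (leqnn k.+2) (expn_bernoulli n.+1 C k).
  rewrite subSn // mulnDr mulnA mulnCA -[(k.+1 * _ * _)%N]mulnA mulSn addnC.
  have := leq_mul (leqnn k.+1) (leq_mul Cj_le_n (leqnn (n.+1 ^ k)%N)).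
  rewrite -expnS => le_slack le_bern.
  rewrite -(leq_add2l (k.+1 * n.+1 ^ k.+1)) (leq_trans le_bern) //.
  by rewrite addnC leq_add2r.
rewrite -natr_prod -natrM ler_pdivrMr; last first.
  rewrite ltr0n muln_gt0 fact_gt0 /= big_add1 /=.
  by apply: prodn_gt0 => i; apply: a_gt0.
rewrite natr1 -natrX -natrM ler_nat subSS subn0 (leq_trans bern) //.
(* The factor [k.+2] turns [(k+1)!] into [(k+2)!], the factorial of [j n]. *)
apply: (leq_trans (leq_mul (leqnn k.+2) count_bound)).
by rewrite [k.+2`!]factS [X in (_ <= X)%N]mulnC !mulnA.
Qed.
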